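(* Let $(X,L,\delta)$ be a (semimetric-like) ordinal space and let $\mathcal B\subseteq\mathbf B_X$ be some set of balls in $(X,\delta)$. Suppose there exists a semimetric $d$ on $X$ such that (1) for every $z\in\operatorname{ac}(X,d)$ there exists an $\varepsilon>0$ such that $d(x,y)\leqslant d(x,z)+d(z,y)$ for all $x\in X$ and all $y\in B_{\varepsilon}(z)$, and (2) $\mathcal B=\widetilde{\mathbf B}_{(X,d)}$, the set of all open balls of the semimetric space $(X,d)$. Then $\mathcal B$ is a base of some topology on $X$.
   Context: An ordinal space is an ordered triplet $(X,L,\delta)$, also written $(X,\delta)$, where $X$ is a set, $L$ is a linearly ordered set with minimal element $0$, and $\delta\colon X\times X\to L$ is a surjective mapping such that for all $x,y\in X$: (i) $\delta(x,y)=\delta(y,x)$; (ii) $\delta(x,y)=0$ if and only if $x=y$. A cut $(A,B)$ of a linearly ordered set $S$ is a pair with $S=A\cup B$ such that each element of $A$ is less than each element of $B$. For $c\in X$ let $\operatorname{Sp}(c)=\{\delta(c,x)\mid x\in X\}\subseteq L$. A ball at the point $c$ is a set of the form $\{x\in X\mid\delta(c,x)\in A\}$, where $(A,B)$ is a cut of $\operatorname{Sp}(c)$ with $A\neq\varnothing$. $\mathbf B_X$ denotes the set of all balls (at all points) of the ordinal space. A semimetric on $X$ is a function $d\colon X\times X\to[0,\infty)$ with $d(x,y)=d(y,x)$ and ($d(x,y)=0\Leftrightarrow x=y$) for all $x,y\in X$. The open balls of $(X,d)$ are $B_r(x_0)=\{x\in X\colon d(x,x_0)<r\}$ for $x_0\in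 X$, $r>0$. $\operatorname{ac}(X,d)$ is the set of accumulation points, i.e. points $z\in X$ such that every $B_r(z)$, $r>0$, contains a point different from $z$. An ordinal space is semimetric-like if there is a semimetric $d'$ on $X$ such that for all $x,y,z,w\in X$ the comparison ($<$, $=$, $>$) of $\delta(x,y)$ with $\delta(z,w)$ agrees with that of $d'(x,y)$ with $d'(z,w)$. The semimetric $d$ in the statement is not required to be related to $\delta$ in this way. *)

(* Defs.v *)
From HB Require Import structures.
From mathcomp Require Export all_boot all_order all_algebra.
From mathcomp Require Export boolp classical_sets functions reals topology.

Set Implicit Arguments.
Unset Strict Implicit.
Unset Printing Implicit Defensive.

Import Order.TTheory GRing.Theory Num.Theory.

Local Open Scope classical_set_scope.
Local Open Scope ring_scope.

Section OrdinalSpace.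
Context (X : Type) (disp : Order.disp_t) (L : bOrderType disp).
Implicit Types (delta : X -> X -> L) (c : X) (S A B : set L) (U : set X).

(* The minimal element 0 of L is \bot. *)
Definition ordinal_space delta : Prop :=
  [/\ forall l : L, exists x y, delta x y = l,
      forall x y, delta x y = delta y x
    & forall x y, delta x y = \bot%O <-> x = y].

Definition cut S A B : Prop :=
  S = A `|` B /\ forall a b, A a -> B b -> (a < b)%O.

Definition Sp delta c : set L := range (delta c).

Definition ordinal_ball_at delta c U : Prop :=
  exists A B, [/\ cut (Sp delta c) A B, A !=set0 & U = [set x | A (delta c x)]].

Definition ordinal_balls delta : set (set X) :=
  [set U | exists c, ordinal_ball_at delta c U].

End OrdinalSpace.

Section Semimetric.
Context (R : realType) (X : Type).
Implicit Types (d : X -> X -> R) (x z : X) (r : R).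

Definition semimetric d : Prop :=
  [/\ forall x y, 0 <= d x y,
      forall x y, d x y = d y x
    & forall x y, d x y = 0 <-> x = y].

Definition semimetric_ball d x r : set X := [set y | d y x < r].

Definition semimetric_balls d : set (set X) :=
  [set U | exists x r, 0 < r /\ U = semimetric_ball d x r].

Definition ac d : set X :=
  [set z | forall r, 0 < r -> exists y, semimetric_ball d z r y /\ y <> z].

End Semimetric.

(* [Topological X] is the type of topological structures on the carrier X, so
   tau ranges over all topologies on X. *)
Definition base_of_some_topology (X : Type) (B : set (set X)) : Prop :=
  exists tau : Topological X, @basis (Topological.Pack tau) B.

(* Main.v *)
From HB Require Import structures.
Require Import Defs.
From mathcomp Require Import all_boot all_order all_algebra.
From mathcomp Require Import boolp classical_sets functions reals topology.

Import Order.TTheory GRing.Theory Num.Theory.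

Local Open Scope classical_set_scope.
Local Open Scope ring_scope.

(** A family of sets is a base of a topology as soon as it covers [X] and any
    two members meeting at a point [z] both contain a third member around [z].
    Covering is clear for the balls of a semimetric.  For the second condition
    it suffices that every ball containing [z] contains a ball centred at [z]
    ([ball_in_ball]), since the balls centred at [z] form a chain.  A
    semimetric may well violate this, but here there are two cases.  If [z] is
    not an accumulation point, some ball centred at [z] is the singleton [{z}].
    If it is, the triangle inequality through [z], granted for endpoints near
    [z], is exactly what the usual metric argument uses: a point [y] so near with
    [d y z < r - d x z] lies in the ball of radius [r] about [x]. *)

Section BaseCriterion.
Variables (X : Type) (B : set (set X)).
Hypothesis B_cover : forall x, exists2 U, B U & U x.
Hypothesis B_join : forall U V x, B U -> B V -> U x -> V x ->
  exists W, [/\ B W, W x & W `<=` U `&` V].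

(** A copy of [X] depending on the hypotheses on [B], so that the topology
    generated by [B] can be attached to it as an instance. *)
Definition generated_space of (forall x, exists2 U, B U & U x)
    & (forall U V x, B U -> B V -> U x -> V x ->
        exists W, [/\ B W, W x & W `<=` U `&` V]) := X.

Local Notation T := (generated_space B_cover B_join).

HB.instance Definition _ := gen_eqMixin T.
HB.instance Definition _ := gen_choiceMixin T.

Let bigcup_B : \bigcup_(U in B) (U : set T) = setT.
Proof.
apply/seteqP; split=> // x _.
by have [U BU Ux] := B_cover x; exists U.
Qed.

HB.instance Definition _ :=
  @isBaseTopological.Build T (set X) B id bigcup_B B_join.

Lemma base_of_some_topology_cover_join : base_of_some_topology B.
Proof.
exists (Topological.class T); split=> [U BU|x A].
  by exists [set U]; [move=> V -> | rewrite bigcup_set1].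
rewrite nbhsE => -[O [[D DB <-] [U DU Ux]] DA].
exists U; first by split=> //; exact: DB.
by move=> y Uy; apply: DA; exists U.
Qed.

End BaseCriterion.

Section SemimetricBalls.
Variables (R : realType) (X : Type) (d : X -> X -> R).
Hypothesis d_semimetric : semimetric d.

Lemma semimetric_ball_center z r : 0 < r -> semimetric_ball d z r z.
Proof. by case: d_semimetric => _ _ d0; rewrite /semimetric_ball /= (d0 z z).2. Qed.

(** In a semimetric space a ball need not be a neighbourhood of its points;
    the local triangle inequality at [z] restores this at [z]. *)
Lemma ball_in_ball z x r :
  (ac d z -> exists eps, 0 < eps /\
     forall u y, semimetric_ball d z eps y -> d u y <= d u z + d z y) ->
  semimetric_ball d x r z ->
  exists rho, 0 < rho /\ semimetric_ball d z rho `<=` semimetric_ball d x r.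
Proof.
case: d_semimetric => _ dC _ tri_z xrz.
have [/tri_z [eps [eps_gt0 tri]]|not_ac] := pselect (ac d z).
  exists (Num.min eps (r - d z x)); split.
    by rewrite lt_min eps_gt0 subr_gt0.
  move=> y; rewrite /semimetric_ball /= lt_min ltrBrDl => /andP[zy_eps zy_r].
  rewrite dC; apply: le_lt_trans (tri x y zy_eps) _.
  by rewrite (dC x z) (dC z y).
have /existsNP[rho /not_implyP[rho_gt0 isol]] := not_ac.
exists rho; split=> // y zy.
have -> // : y = z.
by apply: contrapT => yz; apply: isol; exists y.
Qed.

End SemimetricBalls.

Theorem proposition4p4 (R : realType) (X : Type) (disp : Order.disp_t)
    (L : bOrderType disp) (delta : X -> X -> L)
    (hdelta : ordinal_space delta)
    (B : set (set X)) (hB : B `<=` ordinal_balls delta)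
    (hd : exists d : X -> X -> R,
      [/\ semimetric d,
          forall z : X, ac d z ->
            exists eps : R, 0 < eps /\
              forall x y : X, semimetric_ball d z eps y ->
                d x y <= d x z + d z y
        & B = semimetric_balls d]) :
  base_of_some_topology B.
Proof.
case: hd => d [d_semi tri ->].
apply: base_of_some_topology_cover_join => [x|U V z].
  by exists (semimetric_ball d x 1); [exists x, 1 | exact: semimetric_ball_center].
move=> [x [r [_ ->]]] [y [s [_ ->]]] xz yz.
have [rho [rho_gt0 sub_x]] := ball_in_ball _ _ _ d_semi _ _ _ (tri z) xz.
have [sig [sig_gt0 sub_y]] := ball_in_ball _ _ _ d_semi _ _ _ (tri z) yz.
have min_gt0 : 0 < Num.min rho sig by rewrite lt_min rho_gt0.
exists (semimetric_ball d z (Num.min rho sig)); split.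
- by exists z, (Num.min rho sig).
- exact: semimetric_ball_center.
- move=> w; rewrite /semimetric_ball /= lt_min => /andP[w_rho w_sig].
  by split; [exact: sub_x | exact: sub_y].
Qed.
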